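(* Let $\varphi=(f_1,\dots,f_n):\mathbb{A}^n\to\mathbb{A}^n$ be a polynomial map of degree two which has no contracted divisors, and let $\tau$ be the nontrivial element of $\mathrm{Gal}(K(x_1,\dots,x_n)/K(f_1,\dots,f_n))$. Then there exist a nonzero constant $c\in K^\times$ and an irreducible polynomial $s\in K[x_1,\dots,x_n]$ with $\tau(s)=-s$ such that $|J(\varphi)|=c\,s$. In particular $|J(\varphi)|$ is irreducible and $\tau(|J(\varphi)|)=-|J(\varphi)|$.
   Context: Let $K$ be an algebraically closed field of characteristic zero, $n\ge 1$, and $\mathbb{A}^n$ affine $n$-space over $K$. A polynomial map is $\varphi=(f_1,\dots,f_n):\mathbb{A}^n\to\mathbb{A}^n$ with $f_i\in K[x_1,\dots,x_n]$; $J(\varphi)=(\partial f_i/\partial x_j)$ is its Jacobian matrix and $|J(\varphi)|=\det J(\varphi)$. $K(f_1,\dots,f_n)\subseteq K(x_1,\dots,x_n)$ denotes the subfield generated by the $f_i$. An irreducible closed subvariety $X\subseteq\mathbb{A}^n$ is contracted by $\varphi$ if $\dim X>\dim\overline{\varphi(X)}$; a contracted divisor is an irreducible hypersurface $V(h)$ ($h$ an irreducible polynomial) that is contracted by $\varphi$. The map $\varphi$ has degree two if it is dominant (equivalently $|J(\varphi)|\neq 0$) and $[K(x_1,\dots,x_n):K(f_1,\dots,f_n)]=2$; this extension is then Galois with group $\{\mathrm{id},\tau\}$, $\tau$ a field automorphism of $K(x_1,\dots,x_n)$ of order two fixing $K(f_1,\dots,f_n)$. *)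

(* Defs.v *)
From HB Require Import structures.
From mathcomp Require Import all_boot all_order all_algebra.
From mathcomp Require Import fraction.
From mathcomp Require Export mpoly.
Set Implicit Arguments. Unset Strict Implicit. Unset Printing Implicit Defensive.
Import Order.TTheory GRing.Theory Num.Theory.
Local Open Scope ring_scope.

Notation "x %:F" := (@FracField.tofrac _ x) : ring_scope.

Section Defs.
Variables (K : fieldType) (n : nat).

Definition ratfun := {fraction {mpoly K[n]}}.

Definition polymap := n.-tuple {mpoly K[n]}.

Definition jacobian (f : polymap) : 'M[{mpoly K[n]}]_n :=
  \matrix_(i < n, j < n) mderiv j (tnth f i).
Definition jacdet (f : polymap) : {mpoly K[n]} := \det (jacobian f).

Definition mirreducible (p : {mpoly K[n]}) : Prop :=
  [/\ p != 0, p \isn't a GRing.unit &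
      forall a b : {mpoly K[n]}, p = a * b ->
        a \is a GRing.unit \/ b \is a GRing.unit].

Definition subfield_gen (f : polymap) : ratfun -> Prop :=
  fun u => exists P Q : {mpoly K[n]}, (Q \mPo f) != 0 /\
                 u = (P \mPo f)%:F / (Q \mPo f)%:F.

Definition ext_degree_two (F : ratfun -> Prop) : Prop :=
  exists e1 e2 : ratfun,
    (forall a b, F a -> F b -> a * e1 + b * e2 = 0 -> a = 0 /\ b = 0) /\
    (forall u, exists a b, [/\ F a, F b & u = a * e1 + b * e2]).

(* phi has degree two: dominant (|J| <> 0) and [K(x) : K(f)] = 2. *)
Definition degree_two (f : polymap) : Prop :=
  jacdet f != 0 /\ ext_degree_two (subfield_gen f).

Definition point := 'I_n -> K.
Definition apply_map (f : polymap) (x : point) : point :=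
  fun i => (tnth f i).@[x].

Definition vars_in (I : {set 'I_n}) (p : {mpoly K[n]}) : bool :=
  all (fun m : 'X_{1..n} => [forall i, (i \notin I) ==> (m i == 0%N)]) (msupp p).

(* dim (Zariski closure of S) >= k: some k coordinate functions are
   algebraically independent on S, i.e. no nonzero polynomial in those
   coordinates vanishes identically on S. *)
Definition dim_ge (S : point -> Prop) (k : nat) : Prop :=
  exists I : {set 'I_n}, #|I| = k /\
    forall p : {mpoly K[n]}, p != 0 -> vars_in I p ->
      exists x, S x /\ p.@[x] != 0.

Definition zero_set (h : {mpoly K[n]}) : point -> Prop := fun x => h.@[x] = 0.
Definition image_set (f : polymap) (S : point -> Prop) : point -> Prop :=
  fun y => exists x, S x /\ y = apply_map f x.

Definition contracted (f : polymap) (S : point -> Prop) : Prop :=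
  exists k, dim_ge S k /\ ~ dim_ge (image_set f S) k.

Definition no_contracted_divisors (f : polymap) : Prop :=
  forall h : {mpoly K[n]}, mirreducible h -> ~ contracted f (zero_set h).

End Defs.

(* Main.v *)
(* Write A = K[x], B = K[f] and s^2 = D(f) with D irreducible and
   K(x) = K(f)(s).  A divisor V(h) that is not contracted stays "of codimension
   one": some n - 1 of the f_i are algebraically independent on it, so, by a
   resultant, the polynomials q with h | q(f) are the multiples of a single
   irreducible one.  This is used in two ways.  First, coprime factors of a
   square D(f) remain coprime in A, hence are squares, so D of least degree is
   irreducible.  Second, every polynomial is locally at V(h) a quotient of
   elements of B + B s: the map from A^n to the double cover z^2 = D(y) is a
   local isomorphism in codimension one.  Since s generates the ramification of
   the double cover, s is irreducible, and comparing dy_1 ... dy_n / z with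
   dx_1 ... dx_n gives |J| = c s. *)
Require Import Defs.
From HB Require Import structures.
From mathcomp Require Import all_boot all_order all_algebra.
From mathcomp Require Import fraction mpoly generic_quotient ring zify.
From Stdlib Require Import Classical.
Set Implicit Arguments. Unset Strict Implicit. Unset Printing Implicit Defensive.
Import GRing.Theory.
Local Open Scope ring_scope.

(** * Factorial rings and Gauss's lemma *)

Section Divisibility.
Variable R : idomainType.
Implicit Types a b c p x y : R.

Definition rdvd a b := exists c, b = c * a.

Lemma rdvdd a : rdvd a a. Proof. by exists 1; rewrite mul1r. Qed.
Lemma rdvd0 a : rdvd a 0. Proof. by exists 0; rewrite mul0r. Qed.
Lemma rdvd_trans b a c : rdvd a b -> rdvd b c -> rdvd a c.
Proof. by move=> [x ->] [y ->]; exists (y * x); rewrite mulrA. Qed.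
Lemma rdvd_mull c a b : rdvd a b -> rdvd a (c * b).
Proof. by move=> [x ->]; exists (c * x); rewrite mulrA. Qed.
Lemma rdvd_mulr c a b : rdvd a b -> rdvd a (b * c).
Proof. by rewrite mulrC; apply: rdvd_mull. Qed.
Lemma rdvd_add a b c : rdvd a b -> rdvd a c -> rdvd a (b + c).
Proof. by move=> [x ->] [y ->]; exists (x + y); rewrite mulrDl. Qed.
Lemma rdvd_opp a b : rdvd a b -> rdvd a (- b).
Proof. by move=> [x ->]; exists (- x); rewrite mulNr. Qed.
Lemma rdvd_sub a b c : rdvd a b -> rdvd a c -> rdvd a (b - c).
Proof. by move=> ab ac; apply/rdvd_add/rdvd_opp. Qed.
Lemma rdvd_unit a b : rdvd a b -> b \is a GRing.unit -> a \is a GRing.unit.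
Proof. by move=> [x ->]; rewrite unitrM => /andP[]. Qed.
Lemma unit_rdvd a b : a \is a GRing.unit -> rdvd a b.
Proof. by move=> ua; exists (b / a); rewrite divrK. Qed.

Definition prime_elt p :=
  [/\ p != 0, p \isn't a GRing.unit &
      forall a b, rdvd p (a * b) -> rdvd p a \/ rdvd p b].

Definition irreducible_elt p :=
  [/\ p != 0, p \isn't a GRing.unit &
      forall a b, p = a * b -> a \is a GRing.unit \/ b \is a GRing.unit].

Lemma prime_irreducible p : prime_elt p -> irreducible_elt p.
Proof.
move=> [p0 pU pP]; split=> // a b pab.
have [[c ac]|[c bc]] := pP a b (eq_ind p _ (rdvdd p) _ pab).
- right; apply/unitrPr; exists c; apply: (mulfI p0).
  by rewrite mulr1 {2}pab ac; ring.
- left; apply/unitrPr; exists c; apply: (mulfI p0).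
  by rewrite mulr1 {2}pab bc; ring.
Qed.

Lemma prime_rdvd_irreducible p x : prime_elt p -> irreducible_elt x ->
  rdvd p x -> rdvd x p.
Proof.
move=> [_ pU _] [_ _ xP] [c xE]; have [uc|up] := xP _ _ xE.
  by exists c^-1; rewrite xE mulKr.
by rewrite up in pU.
Qed.

Lemma prime_rdvd_prod (I : eqType) p (s : seq I) (F : I -> R) : prime_elt p ->
  rdvd p (\prod_(i <- s) F i) -> exists2 i, i \in s & rdvd p (F i).
Proof.
move=> [p0 pU pP]; elim: s => [|i s IH]; rewrite ?big_nil ?big_cons.
  by move=> /rdvd_unit/(_ (unitr1 _)) up; rewrite up in pU.
move=> /pP[pi|/IH[j js pj]]; first by exists i; rewrite ?mem_head.
by exists j; rewrite // in_cons js orbT.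
Qed.

Lemma unit_mul_irreducible u p : u \is a GRing.unit -> irreducible_elt p ->
  irreducible_elt (u * p).
Proof.
move=> uu [p0 pU pP]; split; last 1 first.
- move=> a b E; have [|ua|ub] := pP (u^-1 * a) b; last by right.
    by rewrite -mulrA -E mulKr.
  by left; move: ua; rewrite unitrM => /andP[].
- by rewrite mulf_neq0 //; apply: contraTneq uu => ->; rewrite unitr0.
- by rewrite unitrM (negPf pU) andbF.
Qed.

(** The factors are required to be prime and not merely irreducible: uniqueness of the factorisation
    is then automatic, and irreducible elements turn out to be prime. *)
Definition factorial_ring := forall x, x != 0 -> exists u (s : seq R),
  [/\ u \is a GRing.unit, forall p, p \in s -> prime_elt p
    & x = u * \prod_(p <- s) p].

Hypothesis factR : factorial_ring.

Lemma exists_prime_divisor x : x != 0 -> x \isn't a GRing.unit ->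
  exists2 p, prime_elt p & rdvd p x.
Proof.
move=> x0 xU; have [u [[|p s] [uu ps xE]]] := factR x0.
  by rewrite xE big_nil mulr1 uu in xU.
exists p; first by apply: ps; rewrite mem_head.
by rewrite xE big_cons; exists (u * \prod_(q <- s) q); ring.
Qed.

Lemma irreducible_prime p : irreducible_elt p -> prime_elt p.
Proof.
move=> ip; have [p0 pU pP] := ip.
have [q qP qp] := exists_prime_divisor p0 pU.
have pq := prime_rdvd_irreducible qP ip qp.
split=> // a b pab; have [_ _ H] := qP.
by have [] := H a b (rdvd_trans qp pab); [left|right]; apply: rdvd_trans pq _.
Qed.

End Divisibility.

Lemma prime_iso (R S : idomainType) (phi : {rmorphism R -> S})
    (psi : {rmorphism S -> R}) p :
  cancel phi psi -> cancel psi phi -> prime_elt p -> prime_elt (phi p).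
Proof.
move=> phiK psiK [p0 pU pP]; split.
- by rewrite -(rmorph0 phi) (can_eq phiK).
- by apply: contra pU => /(rmorph_unit psi); rewrite phiK.
move=> a b [c abE].
have [|[d E]|[d E]] := pP (psi a) (psi b).
+ by exists (psi c); rewrite -rmorphM abE rmorphM phiK.
+ by left; exists (phi d); rewrite -rmorphM -E psiK.
+ by right; exists (phi d); rewrite -rmorphM -E psiK.
Qed.

Lemma factorial_iso (R S : idomainType) (phi : {rmorphism R -> S})
    (psi : {rmorphism S -> R}) :
  cancel phi psi -> cancel psi phi -> factorial_ring R -> factorial_ring S.
Proof.
move=> phiK psiK factR x x0.
have /factR[u [s [uu sP xE]]] : psi x != 0 by rewrite -(rmorph0 psi) (can_eq psiK).
exists (phi u), (map phi s); split; first exact: rmorph_unit.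
  by move=> _ /mapP[p /sP pP ->]; apply: prime_iso pP.
by rewrite -[x]psiK xE rmorphM rmorph_prod big_map.
Qed.

(** * Polynomials over a factorial ring *)

Section Gauss.
Variable R : idomainType.
Implicit Types (p q a b : {poly R}) (c : R).

Lemma cancel_lead_coef c p : rdvd c (lead_coef p) ->
  exists d, lead_coef p = d * c /\
    (size (p - d%:P * c%:P * 'X^((size p).-1))%R <= (size p).-1)%N.
Proof.
move=> [d dE]; exists d; split=> //.
rewrite -polyCM -dE mul_polyC; apply/leq_sizeP => j jp.
rewrite coefB coefZ coefXn lead_coefE.
have [->|nj] := eqVneq j (size p).-1; first by rewrite mulr1 subrr.
rewrite mulr0 subr0; apply: nth_default.
apply: leq_trans (leqSpred _) _; rewrite ltn_neqAle jp andbT; by rewrite eq_sym.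
Qed.

(** Induction on the sum of the sizes: c divides the product of the two leading coefficients, hence
    one of them, and removing that leading term does not affect divisibility by c. *)
Lemma prime_polyC c : prime_elt c -> prime_elt c%:P.
Proof.
move=> [c0 cU cP]; split; first by rewrite polyC_eq0.
  by rewrite poly_unitE size_polyC c0 coefC.
suff H k a b : (size a + size b <= k)%N -> rdvd c%:P (a * b) ->
   rdvd c%:P a \/ rdvd c%:P b.
  by move=> a b; apply: (H _ _ _ (leqnn _)).
elim: k a b => [|k IH] a b sab cab.
  move: sab; rewrite leqn0 addn_eq0 !size_poly_eq0 => /andP[/eqP-> _].
  by left; apply: rdvd0.
have [->|a0] := eqVneq a 0; first by left; apply: rdvd0.
have [->|b0] := eqVneq b 0; first by right; apply: rdvd0.
have sa : (0 < size a)%N by rewrite size_poly_gt0.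
have sb : (0 < size b)%N by rewrite size_poly_gt0.
have : rdvd c (lead_coef a * lead_coef b).
  rewrite -lead_coefM; have [d ->] := cab; exists (lead_coef d).
  by rewrite lead_coefM lead_coefC.
move=> /cP[]/cancel_lead_coef[d [_ sd]].
- have [| |[e eE]|] := IH (a - d%:P * c%:P * 'X^((size a).-1)) b; first lia.
  + rewrite mulrBl; apply: rdvd_sub => //.
    by exists (d%:P * 'X^((size a).-1) * b); ring.
  + by left; exists (e + d%:P * 'X^((size a).-1)); rewrite mulrDl -eE; ring.
  + by right.
- have [| | |[e eE]] := IH a (b - d%:P * c%:P * 'X^((size b).-1)); first lia.
  + rewrite mulrBr; apply: rdvd_sub => //.
    by exists (d%:P * 'X^((size b).-1) * a); ring.
  + by left.
  + by right; exists (e + d%:P * 'X^((size b).-1)); rewrite mulrDl -eE; ring.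
Qed.

Hypothesis factR : factorial_ring R.

(** Each prime factor of c stays prime in R[X], so it divides a or b and can be cancelled there.
    Thus a factorisation over the fraction field descends to R with the same degrees. *)
Lemma clear_constant c p a b : c != 0 -> c%:P * p = a * b ->
  exists a' b', [/\ p = a' * b', size a' = size a & size b' = size b].
Proof.
move=> /factR[u [s [uu sP ->]]] {c}; elim: s a b sP => [|c s IH] a b sP.
  rewrite big_nil mulr1 => pE; exists (u^-1%:P * a), b; split=> //.
    rewrite -mulrA -pE mulrA -polyCM mulVr //; exact: esym (mul1r _).
  rewrite mul_polyC size_scale // invr_eq0.
  by apply: contraTneq uu => ->; rewrite unitr0.
have cP : prime_elt c by apply: sP; rewrite mem_head.
have {}sP r : r \in s -> prime_elt r.
  by move=> rs; apply: sP; rewrite in_cons rs orbT.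
have [c0 _ _] := cP; have c0' : c%:P != 0 by rewrite polyC_eq0.
have [_ _ pcP] := prime_polyC cP.
rewrite big_cons => pE.
have : rdvd c%:P (a * b).
  by rewrite -pE; exists ((u * \prod_(j <- s) j)%:P * p); rewrite !polyCM; ring.
have E d e : d * c%:P * e = a * b -> (u * \prod_(j <- s) j)%:P * p = d * e.
  move=> H; apply: (mulfI c0'); rewrite mulrCA [_ * e]mulrC mulrCA [e * _]mulrC.
  by rewrite mulrA [d * e]mulrC mulrA [_ * d]mulrC mulrA H -pE !polyCM; ring.
move=> /pcP[][d dE].
- have [|a' [b' [-> sa sb]]] := IH d b sP; first by apply: E; rewrite -dE.
  exists a', b'; split=> //; rewrite sa dE mulrC mul_polyC size_scale //.
- have [|a' [b' [-> sa sb]]] := IH a d sP.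
    by apply: E; rewrite -mulrA [_ * d]mulrC -dE.
  exists a', b'; split=> //; rewrite sb dE mulrC mul_polyC size_scale //.
Qed.

(** Over a factorial ring this says, for nonzero p, that the coefficients have no common factor
    besides units. *)
Definition primitive p := forall c, prime_elt c -> ~ rdvd c%:P p.

(** A prime constant dividing p divides its leading coefficient, so at most as many primes can be
    split off as that coefficient has prime factors. *)
Lemma primitive_part p : p != 0 -> exists (t : seq R) q,
  [/\ forall c, c \in t -> prime_elt c, p = (\prod_(c <- t) c)%:P * q,
      size q = size p & primitive q].
Proof.
move=> p0.
have /factR[u [s [uu sP]]] : lead_coef p != 0 by rewrite lead_coef_eq0.
move: (leqnn (size s)); move: {2}(size s) => k.
elim: k => [|k IH] in p p0 u s uu sP *; move=> sk lE.
  exists [::], p; split=> //; first by rewrite big_nil mul1r.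
  move=> c [c0 cU cP] [q qE]; move: lE; rewrite qE lead_coefM lead_coefC.
  move: sk; rewrite leqn0 size_eq0 => /eqP->; rewrite big_nil mulr1 => uE.
  by move: uu; rewrite -uE unitrM (negPf cU) andbF.
have [[r [rs [q pE]]]|nr] := classic (exists r, r \in s /\ rdvd r%:P p).
  have rP := sP _ rs; have [r0 _ _] := rP.
  have q0 : q != 0 by apply: contraNneq p0 => q0; rewrite pE q0 mul0r.
  have [] := IH q q0 u (rem r s) uu.
  - by move=> c /mem_rem; apply: sP.
  - by rewrite size_rem // -subn1 leq_subLR.
  - apply: (mulIf r0).
    by rewrite -{1}(lead_coefC r) -lead_coefM -pE lE (big_rem r rs) /=; ring.
  move=> t [q' [tP qE sq q'P]]; exists (r :: t), q'; split=> //.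
  - by move=> c; rewrite in_cons => /predU1P[->//|/tP].
  - by rewrite pE qE big_cons polyCM; ring.
  - by rewrite sq pE mulrC mul_polyC size_scale.
exists [::], p; split=> //; first by rewrite big_nil mul1r.
move=> c cP [q qE]; apply: nr.
have [|r rs cr] := @prime_rdvd_prod _ _ c s id cP.
  have [c0 cU cP'] := cP.
  have [|[d ud]|//] := cP' u (\prod_(r <- s) r).
  - by rewrite -lE qE lead_coefM lead_coefC; exists (lead_coef q).
  - by move: uu; rewrite ud unitrM (negPf cU) andbF.
have [d dE] := prime_rdvd_irreducible cP (prime_irreducible (sP _ rs)) cr.
exists r; split=> //; exists (q * d%:P).
by rewrite qE dE polyCM mulrA.
Qed.

(** The primes of c divide q p but not p, so they can be cancelled from q one by one. This brings
    divisibility over the fraction field back to R[X]. *)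
Lemma primitive_rdvd c p q a : primitive p -> c != 0 -> c%:P * a = q * p ->
  rdvd p a.
Proof.
move=> pP /factR[u [s [uu sP ->]]] {c}; elim: s q sP => [|c s IH] q sP.
  rewrite big_nil mulr1 => aE; exists (u^-1%:P * q).
  by rewrite -mulrA -aE mulrA -polyCM mulVr // mul1r.
have cP : prime_elt c by apply: sP; rewrite mem_head.
have [_ _ pcP] := prime_polyC cP; have [c0 _ _] := cP.
rewrite big_cons => aE.
have [|[d dE]|//] := pcP q p; last by have := pP c cP.
  by rewrite -aE; exists ((u * \prod_(j <- s) j)%:P * a); rewrite !polyCM; ring.
apply: (IH d) => [r rs|]; first by apply: sP; rewrite in_cons rs orbT.
apply: (@mulfI _ c%:P); first by rewrite polyC_eq0.
transitivity (q * p); first by rewrite -aE !polyCM; ring.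
by rewrite dE; ring.
Qed.

(** The relation [%|] is divisibility over the fraction field. There p is irreducible by
    [clear_constant], hence prime by Bezout, and [primitive_rdvd] returns to R[X]. *)
Lemma primitive_prime p : primitive p -> (1 < size p)%N ->
    (forall a b, p = a * b -> (size a < size p)%N -> (size b < size p)%N -> False) ->
  prime_elt p.
Proof.
move=> pP sp pI.
have p0 : p != 0 by rewrite -size_poly_gt0; apply: leq_trans sp.
have irr : irreducible_poly p.
  split=> // q sq1 /Pdiv.WeakIdomain.dvdpP[[c r] /= c0 E].
  have [|r' [q' [pE sr sq]]] := @clear_constant c p r q c0.
    by rewrite mul_polyC.
  have [r0 q0] : r' != 0 /\ q' != 0.
    by apply/andP; rewrite -negb_or -mulf_eq0 -pE.
  have sE : size p = (size r' + size q').-1 by rewrite pE size_mul.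
  rewrite -size_poly_gt0 in r0; rewrite -size_poly_gt0 in q0.
  have qp : q %| p by apply/Pdiv.WeakIdomain.dvdpP; exists (c, r).
  rewrite -(dvdp_size_eqp qp) -sq; apply/eqP.
  have := pI _ _ pE; move/eqP: sq1; rewrite -sq; lia.
split=> //; first by rewrite poly_unitE gtn_eqF.
move=> a b [c abE].
have H x : p %| x -> rdvd p x.
  move=> /Pdiv.WeakIdomain.dvdpP[[d r] /= d0 E].
  apply: (@primitive_rdvd d p r) => //.
  by rewrite mul_polyC.
have [/H|npa] := boolP (p %| a); [by left|right; apply: H].
have cop : coprimep p a.
  rewrite /coprimep; apply/negPn/negP => sg.
  have pg := irr _ sg (dvdp_gcdl p a).
  by move/negP: npa; apply; rewrite -(eqp_dvdl _ pg) dvdp_gcdr.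
by rewrite -(Gauss_dvdpr b cop) abE dvdp_mulIr.
Qed.

Theorem factorial_poly : factorial_ring {poly R}.
Proof.
move=> p; move: (leqnn (size p)); move: {2}(size p) => k.
elim: k => [|k IH] in p *; move=> spk p0.
  by move: spk; rewrite leqn0 size_poly_eq0 (negPf p0).
have [t [q [tP pE sq qP]]] := primitive_part p0; rewrite pE.
suff [u [s [uu sP ->]]] : exists u (s : seq {poly R}),
    [/\ u \is a GRing.unit, forall r, r \in s -> prime_elt r
      & q = u * \prod_(r <- s) r].
  exists u, (map polyC t ++ s); split=> //.
    move=> r; rewrite mem_cat => /orP[/mapP[c /tP cP ->]|/sP//].
    exact: prime_polyC.
  by rewrite big_cat /= big_map rmorph_prod; ring.
have [sq1|sq1] := leqP (size q) 1.
  have := size1_polyC sq1; move: (q`_0) => c qE; exists q, [::].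
  split=> //; last by rewrite big_nil mulr1.
  have c0 : c != 0 by rewrite -polyC_eq0 -qE -size_poly_eq0 sq size_poly_eq0.
  rewrite qE; apply: rmorph_unit; apply/negPn/negP => cU.
  have [r rP [d dE]] := exists_prime_divisor factR c0 cU.
  by apply: (qP r rP); exists d%:P; rewrite qE dE polyCM.
have [[a [b [qE sa sb]]]|nq] := classic (exists a b,
    [/\ q = a * b, (size a < size q)%N & (size b < size q)%N]).
  have [a0 b0] : a != 0 /\ b != 0.
    apply/andP; rewrite -negb_or -mulf_eq0 -qE -size_poly_gt0; exact: ltnW.
  have [|//|u [s [uu sP aE]]] := IH a; first lia.
  have [|//|v [s' [uv sP' bE]]] := IH b; first lia.
  exists (u * v), (s ++ s'); split; first by rewrite unitrM uu.
    by move=> r; rewrite mem_cat => /orP[/sP|/sP'].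
  by rewrite big_cat /= qE aE bE; ring.
exists 1, [:: q]; split; rewrite ?unitr1 ?big_seq1 ?mul1r //.
move=> r; rewrite inE => /eqP->; apply: primitive_prime => // a b qE sa sb.
by apply: nq; exists a, b.
Qed.

End Gauss.

(** * Singling out a variable of a multivariate polynomial *)

Lemma mpoly_ring_ind (R : comNzRingType) (n : nat) (P : {mpoly R[n]} -> Prop) :
    (forall c, P c%:MP) -> (forall i, P 'X_i) ->
    (forall p q, P p -> P q -> P (p + q)) ->
    (forall p q, P p -> P q -> P (p * q)) ->
  forall p, P p.
Proof.
move=> Pc PX PD PM; apply: mpolyind => [|c m p _ _ Pp]; first by rewrite -mpolyC0.
apply: (PD) => //; rewrite -mul_mpolyC mpolyXE_id; apply: (PM) => //.
elim/big_ind: _ => [| |i _]; [by rewrite -mpolyC1|exact: (PM)|].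
by elim: (m i) => [|k IH]; rewrite ?expr0 -?mpolyC1 // exprS; apply: (PM).
Qed.

Lemma mpoly_rmorph_ext (R : comNzRingType) (n : nat) (S : nzRingType)
    (g h : {rmorphism {mpoly R[n]} -> S}) :
  (forall c, g c%:MP = h c%:MP) -> (forall i, g 'X_i = h 'X_i) -> g =1 h.
Proof.
move=> gC gX; apply: mpoly_ring_ind => // p q gp gq.
  by rewrite !rmorphD gp gq.
by rewrite !rmorphM gp gq.
Qed.

(** The chain rule, checked on constants, variables, sums and products. *)
Lemma mderiv_comp (R : comNzRingType) (n k : nat) (lq : n.-tuple {mpoly R[k]})
    (j : 'I_k) (p : {mpoly R[n]}) :
  mderiv j (p \mPo lq) = \sum_(i < n) (mderiv i p \mPo lq) * mderiv j (tnth lq i).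
Proof.
elim/mpoly_ring_ind: p => [c|l|p q IHp IHq|p q IHp IHq].
- rewrite comp_mpolyC mderivC big1 // => i _.
  by rewrite mderivC comp_mpoly0 mul0r.
- rewrite comp_mpolyXU -tnth_nth (bigD1 l) //= big1 => [|i il].
    by rewrite mderivX mnm1E eqxx scale1r -{1}[U_(l)%MM]add0m addmK mpolyX0
      comp_mpoly1 mul1r addr0.
  by rewrite mderivX mnm1E eq_sym (negPf il) scale0r comp_mpoly0 mul0r.
- rewrite comp_mpolyD mderivD IHp IHq -big_split; apply: eq_bigr => i _ /=.
  by rewrite mderivD comp_mpolyD mulrDl.
- rewrite rmorphM mderivM IHp IHq mulr_suml mulr_sumr -big_split.
  by apply: eq_bigr => i _ /=; rewrite mderivM comp_mpolyD !rmorphM /=; ring.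
Qed.

Section SplitVariable.
Variables (K : fieldType) (n : nat) (i : 'I_n.+1).

(* K[x_0, ..., x_n] viewed as K[x_j, j <> i][x_i]. *)
Definition to_upoly : {mpoly K[n.+1]} -> {poly {mpoly K[n]}} :=
  mmap (@polyC {mpoly K[n]} \o @mpolyC n K)
    (fun k => if unlift i k is Some j then ('X_j)%:P else 'X).

Definition widen_mpoly : {mpoly K[n]} -> {mpoly K[n.+1]} :=
  comp_mpoly [tuple 'X_(lift i j) | j < n].

HB.instance Definition _ := GRing.RMorphism.on to_upoly.
HB.instance Definition _ := GRing.RMorphism.on widen_mpoly.

Definition of_upoly : {poly {mpoly K[n]}} -> {mpoly K[n.+1]} :=
  horner_eval 'X_i \o map_poly widen_mpoly.
HB.instance Definition _ := GRing.RMorphism.on of_upoly.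

Lemma to_upolyC c : to_upoly c%:MP = (c%:MP)%:P.
Proof. exact: mmapC. Qed.
Lemma to_upolyX k :
  to_upoly 'X_k = if unlift i k is Some j then ('X_j)%:P else 'X.
Proof. by rewrite /to_upoly mmapX mmap1U. Qed.
Lemma widen_mpolyC c : widen_mpoly c%:MP = c%:MP.
Proof. exact: comp_mpolyC. Qed.
Lemma widen_mpolyX j : widen_mpoly 'X_j = 'X_(lift i j).
Proof. by rewrite /widen_mpoly comp_mpolyXU -tnth_nth tnth_mktuple. Qed.
Lemma of_upolyC c : of_upoly c%:P = widen_mpoly c.
Proof. by rewrite /of_upoly /= map_polyC /horner_eval hornerC. Qed.
Lemma of_upolyX : of_upoly 'X = 'X_i.
Proof. by rewrite /of_upoly /= map_polyX /horner_eval hornerX. Qed.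

Lemma of_upolyD : {morph of_upoly : p q / p + q}.
Proof. exact: rmorphD. Qed.
Lemma of_upolyM : {morph of_upoly : p q / p * q}.
Proof. exact: rmorphM. Qed.

Lemma to_upolyK : cancel to_upoly of_upoly.
Proof.
apply: (mpoly_rmorph_ext (g := of_upoly \o to_upoly) (h := idfun)) => [c|k] /=.
  by rewrite to_upolyC of_upolyC widen_mpolyC.
rewrite to_upolyX; case: unliftP => [j|] ->; last exact: of_upolyX.
by rewrite of_upolyC widen_mpolyX.
Qed.

Lemma to_upoly_widen c : to_upoly (widen_mpoly c) = c%:P.
Proof.
move: c; apply: (mpoly_rmorph_ext (g := to_upoly \o widen_mpoly) (h := polyC)) =>
  [c|k] /=.
  by rewrite widen_mpolyC to_upolyC.
by rewrite widen_mpolyX to_upolyX liftK.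
Qed.

Lemma of_upolyK : cancel of_upoly to_upoly.
Proof.
elim/poly_ind => [|p c IH]; first by rewrite !rmorph0.
rewrite !rmorphD !rmorphM /= IH of_upolyC of_upolyX to_upoly_widen to_upolyX.
by rewrite unlift_none.
Qed.

Lemma to_upoly_inj : injective to_upoly. Proof. exact: can_inj to_upolyK. Qed.
Lemma to_upoly_eq0 p : (to_upoly p == 0) = (p == 0).
Proof. by rewrite -(rmorph0 to_upoly) (inj_eq to_upoly_inj). Qed.
Lemma widen_mpoly_eq0 c : (widen_mpoly c == 0) = (c == 0).
Proof. by rewrite -to_upoly_eq0 to_upoly_widen polyC_eq0. Qed.

Lemma of_upoly_lincomb u v p q :
  of_upoly (u * to_upoly p + v * to_upoly q) = of_upoly u * p + of_upoly v * q.
Proof.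
rewrite -{2}[p]to_upolyK -{2}[q]to_upolyK.
by rewrite -(of_upolyM u) -(of_upolyM v) -of_upolyD.
Qed.

Lemma to_upoly_prime p : prime_elt p -> prime_elt (to_upoly p).
Proof. exact: (@prime_iso _ _ to_upoly of_upoly p to_upolyK of_upolyK). Qed.

Definition extend_point (v : 'I_n -> K) (t : K) : 'I_n.+1 -> K :=
  fun k => if unlift i k is Some j then v j else t.

Lemma meval_extend v t p :
  p.@[extend_point v t] = (map_poly (meval v) (to_upoly p)).[t].
Proof.
apply: (mpoly_rmorph_ext (g := meval (extend_point v t))
  (h := horner_eval t \o map_poly (meval v) \o to_upoly)) => [c|k] /=.
  by rewrite to_upolyC map_polyC /= !mevalC /horner_eval hornerC.
rewrite to_upolyX mevalXU /extend_point /horner_eval.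
by case: unliftP => [j|] _; rewrite ?map_polyC ?map_polyX ?hornerC ?hornerX //= mevalXU.
Qed.

Lemma vars_inP (I : {set 'I_n.+1}) (p : {mpoly K[n.+1]}) :
  reflect (forall m k, m \in msupp p -> k \notin I -> m k = 0%N) (vars_in I p).
Proof.
apply: (iffP allP) => [H m k /H/forallP/(_ k)/implyP kI /kI/eqP //|H m mp].
by apply/forallP => k; apply/implyP => kI; apply/eqP/H.
Qed.

Lemma vars_in_to_upoly p : vars_in [set~ i] p -> exists c, to_upoly p = c%:P.
Proof.
move=> /vars_inP pi; exists (to_upoly p).[0].
(* [theta] substitutes 0 for x_i; it fixes every monomial of p, since none of them contains x_i. *)
pose theta : {rmorphism {poly {mpoly K[n]}} -> {poly {mpoly K[n]}}} :=
  (@polyC {mpoly K[n]}) \o (horner_eval 0).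
rewrite -[RHS]/(theta _) /to_upoly /mmap rmorph_sum; apply: eq_big_seq => m mp.
rewrite rmorphM /=; congr (_ * _); first by rewrite /horner_eval hornerC.
rewrite /mmap1 rmorph_prod rmorph_prod; apply: eq_bigr => k _.
case: unliftP => [j|] ->; first by rewrite !rmorphXn /= /horner_eval hornerC.
by rewrite (pi m i mp) ?expr0 ?rmorph1 // !inE eqxx.
Qed.

End SplitVariable.

(** * Partial derivatives in characteristic zero *)

Section Derivative0.
Variables (K : fieldType) (n : nat).
Hypothesis charK : [pchar K] =i pred0.

(** If m k > 0, the coefficient of the derivative at [m - U_(k)] is m k times that of p at m, and m
    k is nonzero in K. *)
Lemma mderiv_eq0_supp k (p : {mpoly K[n]}) m :
  mderiv k p = 0 -> m \in msupp p -> m k = 0%N.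
Proof.
move=> dp mp; apply/eqP; apply: contraTT mp; rewrite -lt0n => mk.
have mE : (m - U_(k) + U_(k))%MM = m.
  by apply: submK; apply/mnm_lepP => j; rewrite mnm1E; case: eqP => [<-|].
have := mcoeff_mderiv k p (m - U_(k)); rewrite dp mcoeff0 mE => /esym/eqP.
by rewrite -mulr_natr mulf_eq0 mcoeff_msupp negbK (pcharf0P _).1 // orbF.
Qed.

Lemma mderiv_all0 (p : {mpoly K[n]}) : (forall k, mderiv k p = 0) ->
  exists c, p = c%:MP.
Proof.
move=> dp; exists p@_0%MM; apply: msize1_polyC; rewrite msizeE.
apply/bigmax_leqP_seq => m mp _; rewrite ltnS leqn0 mdeg_eq0.
by apply/eqP/mnmP => k; rewrite mnm0E; apply: mderiv_eq0_supp mp.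
Qed.

Lemma msize_mderiv k (p : {mpoly K[n]}) : (msize (mderiv k p) <= (msize p).-1)%N.
Proof.
rewrite msizeE; apply/bigmax_leqP_seq => m; rewrite mcoeff_msupp mcoeff_mderiv.
move=> mp _; have : (m + U_(k))%MM \in msupp p.
  by rewrite mcoeff_msupp; apply: contraNneq mp => ->; rewrite mul0rn.
by move/msize_mdeg_lt; rewrite mdegD mdeg1 addn1; case: (msize p).
Qed.
End Derivative0.

Lemma vars_in_widen (K : fieldType) (charK : [pchar K] =i pred0) n
  (i : 'I_n.+1) (c : {mpoly K[n]}) : vars_in [set~ i] (widen_mpoly i c).
Proof.
apply/vars_inP => m k mp; rewrite !inE negbK => /eqP->.
apply: (mderiv_eq0_supp charK) mp; rewrite mderiv_comp big1 // => j _.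
rewrite tnth_mktuple mderivX mnm1E (_ : _ == _ = false) ?scale0r ?mulr0 //.
by rewrite eq_sym (negPf (neq_lift _ _)).
Qed.

(** * Units, factoriality and non-vanishing points of polynomials in several variables *)

Section MpolyUnits.
Variables (K : fieldType) (n : nat).
Implicit Types p q : {mpoly K[n]}.

Lemma mpoly_unitP p : reflect (exists2 c, c != 0 & p = c%:MP) (p \is a GRing.unit).
Proof.
apply: (iffP idP) => [|[c c0 ->]].
  by move=> /andP[/eqP pE]; rewrite unitfE; exists p@_0%MM.
by apply: (rmorph_unit (@mpolyC n K)); rewrite unitfE.
Qed.

Lemma mpoly_nonunit_size p : p != 0 -> p \isn't a GRing.unit -> (1 < msize p)%N.
Proof.
move=> p0; apply: contraR; rewrite -leqNgt => /msize1_polyC pE.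
by apply/mpoly_unitP; exists p@_0%MM; rewrite // -(mpolyC_eq0 n) -pE.
Qed.

Lemma msize_lt_divisor p q : p * q != 0 -> p \isn't a GRing.unit ->
  (msize q < msize (p * q))%N.
Proof.
rewrite mulf_eq0 negb_or => /andP[p0 q0] /(mpoly_nonunit_size p0) sp.
rewrite msizeM //; rewrite -msize_poly_eq0 in q0.
by case: (msize p) (msize q) sp q0 => [|[|a]] [|b] //= _ _; lia.
Qed.

End MpolyUnits.

Lemma factorial_mpoly (K : fieldType) n : factorial_ring {mpoly K[n]}.
Proof.
elim: n => [|n IH].
  move=> p p0; exists p, [::]; split; rewrite ?big_nil ?mulr1 //.
  have pE := nvar0_mpolyC_eq p (erefl 0%N).
  by apply/mpoly_unitP; exists p@_0%MM; rewrite // -(mpolyC_eq0 0) -pE.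
apply: (factorial_iso (@of_upolyK K n ord0) (@to_upolyK K n ord0)).
exact: factorial_poly.
Qed.

Lemma poly_nonroot (K : closedFieldType) (p : {poly K}) : p != 0 ->
  exists t, p.[t] != 0.
Proof.
move=> p0; have [/size1_polyC pE|sp] := leqP (size p) 1.
  by exists 0; rewrite pE hornerC -polyC_eq0 -pE.
(* At a root of p - 1 the value of p is 1. *)
have /closed_rootP[t] : size (p - 1) != 1%N.
  by rewrite size_polyDl ?neq_ltn ?sp ?orbT // size_polyN size_poly1.
rewrite rootE hornerD hornerN hornerC subr_eq0 => /eqP pt.
by exists t; rewrite pt oner_eq0.
Qed.

Lemma mpoly_nonroot (K : closedFieldType) n (p : {mpoly K[n]}) : p != 0 ->
  exists v, p.@[v] != 0.
Proof.
elim: n p => [|n IH] p p0.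
  have pE := nvar0_mpolyC_eq p (erefl 0%N).
  by exists (fun _ => 0); rewrite pE mevalC -(mpolyC_eq0 0) -pE.
have [|v vl] := IH (lead_coef (to_upoly ord0 p)).
  by rewrite lead_coef_eq0 to_upoly_eq0.
have [|t vt] := @poly_nonroot K (map_poly (meval v) (to_upoly ord0 p)).
  by rewrite -lead_coef_eq0 lead_coef_map_eq.
by exists (extend_point ord0 v t); rewrite meval_extend.
Qed.

(** * Divisors that are not contracted *)

(** Let g be a gcd of positive degree. The prime p divides c p = r g; as r is nonzero and of smaller
    degree, p divides g. Hence p divides d q with d a nonzero constant, and so p divides q. *)
Lemma prime_coprimep_or_rdvd (R : idomainType) (p q : {poly R}) :
  prime_elt p -> (1 < size p)%N -> coprimep p q \/ rdvd p q.
Proof.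
move=> [p0 pU pP] sp; have [|sg] := boolP (coprimep p q); [by left|right].
have /Pdiv.WeakIdomain.dvdpP[[c r] /= c0 pE] := dvdp_gcdl p q.
have /Pdiv.WeakIdomain.dvdpP[[d k] /= d0 qE] := dvdp_gcdr p q.
set g := gcdp p q in pE qE sg.
have g0 : g != 0 by rewrite gcdp_eq0 (negPf p0).
have sg' : (1 < size g)%N.
  by move: sg; rewrite /coprimep -/g -size_poly_gt0 in g0 *; lia.
have small (x : {poly R}) : x != 0 -> (size x < size p)%N -> ~ rdvd p x.
  move=> x0 sx [y yE]; move: sx; rewrite yE size_mul //; last first.
    by apply: contraNneq x0 => y0; rewrite yE y0 mul0r.
  have : y != 0 by apply: contraNneq x0 => y0; rewrite yE y0 mul0r.
  by rewrite -size_poly_gt0; lia.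
have r0 : r != 0.
  apply: contraNneq p0 => r0; move/eqP: pE.
  by rewrite r0 mul0r -mul_polyC mulf_eq0 polyC_eq0 (negPf c0).
have pg : rdvd p g.
  have [||//] := pP r g; first by rewrite -pE; exists c%:P; rewrite mul_polyC.
  move=> /small -/(_ r0) []; rewrite -(size_scale p c0) pE size_mul //.
  by rewrite -size_poly_gt0 in r0; lia.
have [||//] := pP d%:P q; first by rewrite mul_polyC qE; apply: rdvd_mull.
move=> /small []; first by rewrite polyC_eq0.
by rewrite size_polyC d0.
Qed.

Section Contraction.
Variables (K : closedFieldType) (n : nat).
Hypothesis charK : [pchar K] =i pred0.
Implicit Types (h p q : {mpoly K[n.+1]}) (f : polymap K n.+1).

Lemma mirreducible_prime h : mirreducible h -> prime_elt h.
Proof. by move=> hI; apply: irreducible_prime => //; apply: factorial_mpoly. Qed.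

(* Choose the other coordinates generically and solve h = 0 for a variable
   occurring in h. *)
Lemma dim_ge_zero_set h : mirreducible h -> dim_ge (zero_set h) n.
Proof.
(* Some variable x_i occurs in h: otherwise all partial derivatives of h would vanish and h would be
   constant, hence a unit. *)
move=> [h0 hU _]; have [i hi] : exists i, (1 < size (to_upoly i h))%N.
  apply: NNPP => H; move/negP: hU; apply; apply/mpoly_unitP.
  have [|c hE] := @mderiv_all0 K n.+1 charK h.
    move=> k; have /size1_polyC : (size (to_upoly k h) <= 1)%N.
      by rewrite leqNgt; apply/negP => sk; apply: H; exists k.
    move: (_`_0) => c /(canRL (to_upolyK k)) ->; rewrite of_upolyC.
    rewrite mderiv_comp big1 // => j _.
    rewrite tnth_mktuple mderivX mnm1E (_ : _ == _ = false) ?scale0r ?mulr0 //.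
    by rewrite eq_sym (negPf (neq_lift _ _)).
  by exists c; rewrite // -(mpolyC_eq0 n.+1) -hE.
exists [set~ i]; split; first by rewrite cardsC1 card_ord.
move=> p p0 /vars_in_to_upoly[c pE].
have c0 : c != 0 by rewrite -polyC_eq0 -pE to_upoly_eq0.
set l := lead_coef (to_upoly i h).
have l0 : l != 0 by rewrite lead_coef_eq0 to_upoly_eq0.
have [v] : exists v, (c * l).@[v] != 0 by apply: mpoly_nonroot; rewrite mulf_neq0.
rewrite mevalM mulf_eq0 negb_or => /andP[cv lv].
have /closed_rootP[t /rootP ht] : size (map_poly (meval v) (to_upoly i h)) != 1%N.
  by rewrite size_poly_eq // gtn_eqF.
exists (extend_point i v t); rewrite /zero_set !meval_extend; split=> //.
by rewrite pE map_polyC hornerC.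
Qed.

(** In affine (n+1)-space V(h) has dimension at least n, and so has its image. The index i is the
    one left out of n coordinates that are independent on the image. *)
Lemma not_contracted_vars f h : no_contracted_divisors f -> mirreducible h ->
  exists i : 'I_n.+1, forall c, c != 0 -> ~ rdvd h (widen_mpoly i c \mPo f).
Proof.
move=> fN hI; have [I [cI IP]] : dim_ge (image_set f (zero_set h)) n.
  by apply: NNPP => H; apply: (fN h hI); exists n; split=> //; apply: dim_ge_zero_set.
have /cards1P[i iE] : #|~: I| == 1%N by rewrite cardsCs setCK cI card_ord subSnn.
exists i => c c0 [q qE].
have [||y [[x [hx ->]]]] := IP (widen_mpoly i c).
- by rewrite widen_mpoly_eq0.
- by rewrite -[I]setCK iE; apply: vars_in_widen.
by rewrite -comp_mpoly_meval qE mevalM hx mulr0 eqxx.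
Qed.

(** If p did not divide q, a Bezout relation u p + v q = c would eliminate x_i. Composed with f it
    would make h divide c(f) for a nonzero c free of x_i. *)
Lemma rdvd_comp f h p q : no_contracted_divisors f -> mirreducible h ->
  mirreducible p -> rdvd h (p \mPo f) -> rdvd h (q \mPo f) -> rdvd p q.
Proof.
move=> fN hI pI hp hq; have [i iP] := not_contracted_vars fN hI.
have p'P : prime_elt (to_upoly i p).
  exact/to_upoly_prime/mirreducible_prime.
have [p0 _ _] := pI.
have [/size1_polyC|sp] := leqP (size (to_upoly i p)) 1.
  move: (_`_0) => c pE; case: (iP c).
    by rewrite -polyC_eq0 -pE to_upoly_eq0.
  by rewrite -of_upolyC -pE to_upolyK.
have [/Bezout_coprimepP[[u v] /=]|[c qE]] :=
  prime_coprimep_or_rdvd (to_upoly i q) p'P sp; last first.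
  by exists (of_upoly i c); rewrite -[q](to_upolyK i) qE of_upolyM to_upolyK.
rewrite -size_poly_eq1 => /size_poly1P[c c0 cE]; case: (iP c c0).
have E : widen_mpoly i c = of_upoly i u * p + of_upoly i v * q.
  by rewrite -of_upolyC -cE of_upoly_lincomb.
rewrite E comp_mpolyD; apply: rdvd_add; rewrite rmorphM; exact: rdvd_mull.
Qed.

End Contraction.

(** * Algebraic independence of the f_i when |J| is nonzero *)

Section Dominant.
Variables (K : fieldType) (n : nat).
Hypothesis charK : [pchar K] =i pred0.
Variable f : polymap K n.
Hypothesis domf : jacdet f != 0.

Lemma jacobian_inj (r : 'rV_n) : r *m jacobian f = 0 -> r = 0.
Proof.
move=> rJ; have : r *m (jacobian f *m \adj (jacobian f)) = 0.
  by rewrite mulmxA rJ mul0mx.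
rewrite mul_mx_adj mul_mx_scalar => /rowP rE; apply/rowP => j.
by move/eqP: (rE j); rewrite !mxE mulf_eq0 (negPf domf) => /eqP.
Qed.

(** Induction on the degree: by the chain rule (grad p)(f) is killed by the Jacobian matrix, hence
    is zero. The derivatives of p are then zero by induction, and p is constant. *)
Lemma comp_dominant_eq0 p : p \mPo f = 0 -> p = 0.
Proof.
move: (leqnn (msize p)); move: {2}(msize p) => k.
elim: k => [|k IH] in p *; move=> sp pf.
  by apply/eqP; rewrite -msize_poly_eq0 -leqn0.
have [c pE] : exists c, p = c%:MP; last by move: pf; rewrite pE comp_mpolyC.
apply: mderiv_all0 => // i.
have [/eqP|p0] := boolP (p == 0); first by move=> ->; rewrite mderiv0.
apply: IH; first by have := msize_mderiv i p; lia.
have : \row_j (mderiv j p \mPo f) = 0.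
  apply: jacobian_inj; apply/rowP => j; rewrite !mxE.
  transitivity (mderiv j (p \mPo f)); last by rewrite pf mderiv0.
  by rewrite mderiv_comp; apply: eq_bigr => l _; rewrite !mxE.
by move=> /rowP/(_ i); rewrite !mxE.
Qed.

End Dominant.

(** * Quadratic extensions of K(f) *)

Lemma fraction_surj (R : idomainType) (w : {fraction R}) :
  exists p q : R, q != 0 /\ w = p%:F / q%:F.
Proof.
elim/quotW: w => x; exists (frac x).1, (frac x).2.
have d0 := denom_ratioP x; split=> //.
apply: (mulIf (x := (frac x).2%:F)); first by rewrite tofrac_eq0.
rewrite divfK ?tofrac_eq0 //; unlock FracField.tofrac.
rewrite -[LHS]FracField.pi_mul; apply/eqmodP.
rewrite /= FracField.equivfE /FracField.mulf.
rewrite !numden_Ratio ?oner_eq0 ?mulf_neq0 ?mulr1 ?oner_neq0 //.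
by apply/eqP; rewrite mulrC.
Qed.

Lemma closed_sqrt (K : closedFieldType) (c : K) : exists e, e ^+ 2 = c.
Proof.
have [e eP] := @solve_monicpoly K 2 (fun k => if k == 0%N then c else 0) isT.
exists e; rewrite eP big_ord_recl big_ord1 /=; ring.
Qed.

(** * Squares and square roots in K[x] *)

Section Squares.
Variables (K : closedFieldType) (n : nat).
Implicit Types (p q x y w : {mpoly K[n]}).

(** A prime p of x divides w but not y, so p^2 divides x and can be cancelled. The units left at the
    end are squares because K is algebraically closed. *)
Lemma coprime_square x y w : x != 0 -> x * y = w ^+ 2 ->
  (forall p, prime_elt p -> rdvd p x -> rdvd p y -> False) ->
  exists t, x = t ^+ 2.
Proof.
move: (leqnn (msize x)); move: {2}(msize x) => k.
elim: k => [|k IH] in x w *; move=> sx x0 xy cop.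
  by move: sx; rewrite leqn0 msize_poly_eq0 (negPf x0).
have [/mpoly_unitP[c _ ->]|xU] := boolP (x \is a GRing.unit).
  by have [e <-] := closed_sqrt c; exists e%:MP; rewrite rmorphXn.
have [p pP px] := exists_prime_divisor (@factorial_mpoly K n) x0 xU.
have [p0 pU pI] := pP; have npy : ~ rdvd p y by move=> py; apply: cop px py.
have [w' wE] : rdvd p w.
  by case: (pI w w) => //; rewrite -expr2 -xy; apply: rdvd_mulr.
have [x1 x1E] := px.
have x1y : x1 * y = p * w' ^+ 2.
  by apply: (mulfI p0); rewrite mulrA [p * x1]mulrC -x1E xy wE; ring.
have [x2 x2E] : rdvd p x1.
  by have [] // := pI x1 y; rewrite x1y mulrC; exists (w' ^+ 2).
have xE : x = p * (p * x2) by rewrite x1E x2E; ring.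
have [||||t tE] := IH x2 w'.
- rewrite -ltnS (leq_trans _ sx) // xE mulrA.
  apply: msize_lt_divisor; first by rewrite -mulrA -xE.
  by rewrite unitrM (negPf pU).
- by apply: contraNneq x0 => x20; rewrite xE x20 !mulr0.
- by apply: (mulfI p0); rewrite -x1y x2E; ring.
- move=> q qP qx; apply: cop => //; rewrite xE; do 2!apply: rdvd_mull; exact: qx.
by exists (p * t); rewrite xE tE; ring.
Qed.

(** Every prime of the denominator q of p / q divides p^2, hence p, and can be cancelled from
    both. *)
Lemma square_div p q d : q != 0 -> p ^+ 2 = d * q ^+ 2 -> rdvd q p.
Proof.
move: (leqnn (msize q)); move: {2}(msize q) => k.
elim: k => [|k IH] in p q *; move=> sq q0 pq.
  by move: sq; rewrite leqn0 msize_poly_eq0 (negPf q0).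
have [qU|qU] := boolP (q \is a GRing.unit); first exact: unit_rdvd.
have [r rP [q1 qE]] := exists_prime_divisor (@factorial_mpoly K n) q0 qU.
have [r0 rU rI] := rP.
have [p1 pE] : rdvd r p.
  case: (rI p p) => //; rewrite -expr2 pq qE; exists (d * q1 ^+ 2 * r); ring.
have [|||c cE] := IH p1 q1.
- rewrite -ltnS (leq_trans _ sq) // qE mulrC.
  by apply: msize_lt_divisor; rewrite // mulrC -qE.
- by apply: contraNneq q0 => q10; rewrite qE q10 mul0r.
- by apply: (mulfI r0); apply: (mulfI r0); move: pq; rewrite pE qE => E; ring: E.
by exists c; rewrite pE cE qE; ring.
Qed.

Lemma integrally_closed_sqrt (w : ratfun K n) d : w ^+ 2 = d%:F ->
  exists s, w = s%:F.
Proof.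
have [p [q [q0 ->]]] := fraction_surj w => pq.
have [c cE] : rdvd q p.
  apply: (@square_div p q d) => //; apply/eqP; rewrite -tofrac_eq; apply/eqP.
  by rewrite [RHS]rmorphM !rmorphXn /= -pq expr_div_n divfK // expf_neq0 // tofrac_eq0.
by exists c; rewrite cE rmorphM /= mulfK // tofrac_eq0.
Qed.

End Squares.

Lemma complete_square (L : fieldType) (p r u : L) : 2 != 0 :> L ->
  u * u = p + r * u -> (u - r / 2) ^+ 2 = p + (r / 2) * (r / 2).
Proof.
move=> two0 u2; have -> : (u - r / 2) ^+ 2 = u * u - r * u + (r / 2) * (r / 2).
  by field.
by rewrite u2; ring.
Qed.

(** For 1 = a e1 + b e2, u = c e1 + d e2 and D = a d - b c, the two equations are Cramer's formulas;
    the conclusion is the change from the basis e1, e2 to 1, u. *)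
Lemma cramer2 (L : fieldType) (a b c d a' b' D u e1 e2 : L) : D != 0 ->
  d - b * u = D * e1 -> a * u - c = D * e2 ->
  a' * e1 + b' * e2 = (a' * d - b' * c) / D + (b' * a - a' * b) / D * u.
Proof.
move=> D0 E1 E2; apply: (mulfI D0).
transitivity (a' * (D * e1) + b' * (D * e2)); first by ring.
by rewrite -E1 -E2; field.
Qed.

Section Subfield.
Variables (K : fieldType) (n : nat) (f : polymap K n).
Local Notation F := (subfield_gen f).

Lemma subfield_comp p : F (p \mPo f)%:F.
Proof.
by exists p, 1; rewrite comp_mpoly1 oner_eq0 rmorph1 divr1.
Qed.

Lemma subfieldM u v : F u -> F v -> F (u * v).
Proof.
move=> [p [q [q0 ->]]] [p' [q' [q0' ->]]]; exists (p * p'), (q * q').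
by rewrite !rmorphM mulf_neq0 //= invfM; split=> //; rewrite mulrACA.
Qed.

Lemma subfieldV u : F u -> F u^-1.
Proof.
move=> [p [q [q0 ->]]]; have [p0|p0] := eqVneq (p \mPo f) 0.
  by exists 0, 1; rewrite p0 comp_mpoly0 comp_mpoly1 oner_eq0 !rmorph0 !mul0r invr0.
by exists q, p; rewrite invf_div.
Qed.

Lemma subfieldD u v : F u -> F v -> F (u + v).
Proof.
move=> [p [q [q0 ->]]] [p' [q' [q0' ->]]]; exists (p * q' + p' * q), (q * q').
rewrite !(rmorphM, rmorphD) mulf_neq0 //=; split=> //.
by rewrite addf_div ?tofrac_eq0.
Qed.

Lemma subfieldC c : F (c%:MP)%:F.
Proof. by rewrite -(comp_mpolyC c f); apply: subfield_comp. Qed.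

Lemma subfield0 : F 0.
Proof. by rewrite -tofrac0 -mpolyC0; apply: subfieldC. Qed.

Lemma subfieldN u : F u -> F (- u).
Proof.
move=> Fu; rewrite -mulN1r; apply: subfieldM => //.
by have := subfieldC (-1); rewrite mpolyCN mpolyC1 rmorphN rmorph1.
Qed.

Lemma subfieldB u v : F u -> F v -> F (u - v).
Proof. by move=> Fu Fv; apply: subfieldD => //; apply: subfieldN. Qed.

(** The determinant D of the change from e1, e2 to 1, u is nonzero: otherwise d = b u and a u = c
    with a or b nonzero, which puts u in K(f). *)
Lemma subfield_span u v : ext_degree_two F -> ~ F u ->
  exists a b, [/\ F a, F b & v = a + b * u].
Proof.
move=> [e1 [e2 [_ span]]] nFu.
have [a [b [Fa Fb E1]]] := span 1.
have [c [d [Fc Fd Eu]]] := span u.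
have [a' [b' [Fa' Fb' Ev]]] := span v.
pose D := a * d - b * c.
have De1 : d - b * u = D * e1 by rewrite Eu /D -[d]mulr1 {1}E1; ring.
have De2 : a * u - c = D * e2 by rewrite Eu /D -[c]mulr1 {2}E1; ring.
have D0 : D != 0.
  apply/eqP => D0; move: De1 De2; rewrite D0 !mul0r => De1 De2.
  have [b0|b0] := eqVneq b 0; last first.
    by apply: nFu; rewrite (_ : u = d / b); 
      [apply/subfieldM/subfieldV|rewrite (subr0_eq De1) mulrC mulKf].
  have [a0|a0] := eqVneq a 0; last first.
    by apply: nFu; rewrite (_ : u = c / a); 
      [apply/subfieldM/subfieldV|rewrite -(subr0_eq De2) mulrC mulKf].
  by move/eqP: E1; rewrite a0 b0 !mul0r addr0 oner_eq0.
have FD : F D by apply: subfieldB; apply: subfieldM.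
exists ((a' * d - b' * c) / D), ((b' * a - a' * b) / D); split.
- by apply: subfieldM; [apply: subfieldB; apply: subfieldM|apply: subfieldV].
- by apply: subfieldM; [apply: subfieldB; apply: subfieldM|apply: subfieldV].
by rewrite Ev; apply: cramer2.
Qed.

Lemma exists_sqrt u : [pchar K] =i pred0 -> ext_degree_two F -> ~ F u ->
  exists w (D : {mpoly K[n]}), ~ F w /\ w ^+ 2 = (D \mPo f)%:F.
Proof.
move=> charK deg2 nFu; have [p [r [Fp Fr u2]]] := subfield_span (u * u) deg2 nFu.
have two0 : 2 != 0 :> ratfun K n.
  rewrite (_ : 2 = (2%:MP)%:F); last by rewrite mpolyC_nat rmorph_nat.
  by rewrite tofrac_eq0 mpolyC_eq0 (pcharf0P _).1.
have F2 : F 2 by have := subfieldC 2; rewrite mpolyC_nat rmorph_nat.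
have Fr2 : F (r / 2) by apply: subfieldM => //; apply: subfieldV.
have [P [Q [Q0 QE]]] : F (p + (r / 2) * (r / 2)) by apply/subfieldD/subfieldM.
have Q0' : (Q \mPo f)%:F != 0 by rewrite tofrac_eq0.
(* Completing the square makes u - r/2 a square root of P(f) / Q(f); the factor Q(f) turns the
   radicand into the polynomial (P Q)(f). *)
exists ((Q \mPo f)%:F * (u - r / 2)), (P * Q); split.
  move=> FQ; apply: nFu; rewrite -(subrK (r / 2) u); apply: subfieldD => //.
  by rewrite -(mulKf Q0' (u - _)); apply: subfieldM => //; apply/subfieldV/subfield_comp.
rewrite exprMn (complete_square two0 u2) QE ![in RHS]rmorphM /= expr2 -mulrA.
by rewrite [_ * (_ / _)]mulrC divfK // mulrC.
Qed.
End Subfield.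

Lemma div_sqr (L : fieldType) (w t d : L) : t != 0 -> w ^+ 2 = t ^+ 2 * d ->
  (w / t) ^+ 2 = d.
Proof. by move=> t0 wE; rewrite expr_div_n wE mulrC mulKf // expf_neq0. Qed.

(** * A generator of K(x) over K(f) whose square is D(f) with D irreducible *)

Section QuadraticMap.
Variables (K : closedFieldType) (n : nat) (f : polymap K n.+1).
Hypothesis charK : [pchar K] =i pred0.
Hypothesis domf : jacdet f != 0.
Hypothesis fN : no_contracted_divisors f.
Local Notation F := (subfield_gen f).
Implicit Types (h p q u : {mpoly K[n.+1]}).

Lemma comp_neq0 q : q != 0 -> q \mPo f != 0.
Proof. by apply: contraNneq => /(comp_dominant_eq0 charK domf) ->. Qed.

Lemma prime_mirreducible p : prime_elt p -> mirreducible p.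
Proof. exact: prime_irreducible. Qed.

Lemma irreducible_under h q : prime_elt h -> q != 0 -> rdvd h (q \mPo f) ->
  exists p, [/\ mirreducible p, rdvd p q & rdvd h (p \mPo f)].
Proof.
move=> hP q0; have [v [s [uv sP qE]]] := factorial_mpoly q0.
rewrite qE rmorphM rmorph_prod /=; have [_ _ hI] := hP.
move=> /hI[/rdvd_unit|/(prime_rdvd_prod hP)[p ps hp]].
  by move/(_ (rmorph_unit (comp_mpoly f) uv)) => hU; case: hP; rewrite hU.
exists p; split=> //; first exact/prime_mirreducible/sP.
by rewrite (big_rem p ps) /=; exists (v * \prod_(y <- rem p s) y); ring.
Qed.

(** Descent on the degree of D = p D' with p prime. If D' is a unit, D is irreducible. If p divides
    D', divide w by p(f). Otherwise p(f) and D'(f) are coprime by [rdvd_comp], so p(f) = t^2: either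
    t lies outside K(f) and p is the radicand sought, or w / t has the smaller radicand D'. *)
Lemma irreducible_radicand (w : ratfun K n.+1) (D : {mpoly K[n.+1]}) :
    ~ F w -> w ^+ 2 = (D \mPo f)%:F ->
  exists s E : {mpoly K[n.+1]},
    [/\ mirreducible E, s ^+ 2 = E \mPo f & ~ F s%:F].
Proof.
move: (leqnn (msize D)); move: {2}(msize D) => k.
elim: k => [|k IH] in w D *; move=> sD nFw wD.
  case: nFw; move: sD; rewrite leqn0 msize_poly_eq0 => /eqP D0.
  move/eqP: wD; rewrite D0 comp_mpoly0 rmorph0 sqrf_eq0 => /eqP->.
  exact: subfield0.
have D0 : D != 0.
  apply/eqP => D0; apply: nFw.
  move/eqP: wD; rewrite D0 comp_mpoly0 rmorph0 sqrf_eq0 => /eqP->.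
  exact: subfield0.
have DU : D \isn't a GRing.unit.
  apply/negP => /mpoly_unitP[c c0 DE]; apply: nFw; have [e eE] := closed_sqrt c.
  move: wD; rewrite DE comp_mpolyC -eE !rmorphXn /= => /eqP.
  rewrite eqf_sqr => /orP[]/eqP->; first exact: subfieldC.
  exact/subfieldN/subfieldC.
have [p pP [D' DE]] := exists_prime_divisor (@factorial_mpoly K n.+1) D0 DU.
have [p0 pU pI] := pP.
have pf0 : (p \mPo f)%:F != 0 :> ratfun K n.+1 by rewrite tofrac_eq0 comp_neq0.
have sD' : (msize D' < msize D)%N.
  by rewrite DE mulrC; apply: msize_lt_divisor; rewrite // mulrC -DE.
have [D'U|D'U] := boolP (D' \is a GRing.unit).
  have [s sE] := integrally_closed_sqrt wD; exists s, D; split.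
  - by rewrite DE; apply: unit_mul_irreducible => //; apply: prime_irreducible.
  - by apply/eqP; rewrite -tofrac_eq rmorphXn /= -sE wD.
  - by rewrite -sE.
have [[D2 D2E]|npD'] := classic (rdvd p D').
  apply: (IH (w / (p \mPo f)%:F) D2).
  - rewrite -ltnS (leq_trans _ sD) // (leq_ltn_trans _ sD') //.
    have [D20|D20] := eqVneq D2 0; first by rewrite D20 msize0.
    rewrite D2E mulrC ltnW // msize_lt_divisor // mulf_neq0 //.
  - move=> FD; apply: nFw; rewrite -(divfK pf0 w).
    by apply: subfieldM => //; apply: subfield_comp.
  - by rewrite expr_div_n wD DE D2E !rmorphM /= expr2 invfM mulrA !mulfK.
have [s sE] := integrally_closed_sqrt wD.
have sDf : (p \mPo f) * (D' \mPo f) = s ^+ 2.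
  have -> : (p \mPo f) * (D' \mPo f) = D \mPo f by rewrite DE rmorphM mulrC.
  by apply/eqP; rewrite -tofrac_eq rmorphXn /= -sE wD.
have [|t tE] := coprime_square (comp_neq0 p0) sDf.
  move=> h hP hp hD'; apply: npD'.
  exact: (rdvd_comp charK fN (prime_mirreducible hP) (prime_mirreducible pP)).
have [Ft|nFt] := classic (F t%:F); last first.
  by exists t, p; split=> //; exact: prime_mirreducible.
have t0 : t%:F != 0 :> ratfun K n.+1.
  by rewrite tofrac_eq0; have := comp_neq0 p0; rewrite tE expf_eq0.
apply: (IH (w / t%:F) D'); first by rewrite -ltnS (leq_trans sD').
  by move=> FD; apply: nFw; rewrite -(divfK t0 w); apply: subfieldM.
have DfE : D \mPo f = t ^+ 2 * (D' \mPo f) by rewrite -tE DE mulrC rmorphM.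
apply: (div_sqr t0); rewrite wD DfE.
by rewrite tofracM tofracXn.
Qed.

End QuadraticMap.

(** * The double cover z^2 = D(y) *)

Lemma clear_denominators (L : fieldType) (p q p' q' s : L) :
  q != 0 -> q' != 0 ->
  (p / q + p' / q' * s) * (q * q') = p * q' + (p' * q) * s.
Proof. by move=> q0 q0'; field; rewrite q0 q0'. Qed.

Section Ramification.
Variables (K : closedFieldType) (n : nat) (f : polymap K n.+1).
Hypothesis charK : [pchar K] =i pred0.
Hypothesis domf : jacdet f != 0.
Hypothesis fN : no_contracted_divisors f.
Hypothesis deg2 : ext_degree_two (subfield_gen f).
Variables (s D : {mpoly K[n.+1]}).
Hypothesis D_irr : mirreducible D.
Hypothesis s_sqr : s ^+ 2 = D \mPo f.
Hypothesis s_notin : ~ subfield_gen f s%:F.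
Implicit Types (a b h p q u : {mpoly K[n.+1]}).

Lemma sqrt_neq0 : s != 0.
Proof. by apply: contra_not_neq s_notin => ->; rewrite rmorph0; apply: subfield0. Qed.

Lemma integral_span u : exists q a b,
  q != 0 /\ u * (q \mPo f) = a \mPo f + (b \mPo f) * s.
Proof.
have [a [b [[p [q [q0 aE]]] [p' [q' [q0' bE]]] uE]]] :=
  subfield_span u%:F deg2 s_notin.
exists (q * q'), (p * q'), (p' * q); split.
  apply/eqP => qq; have := mulf_neq0 q0 q0'.
  by rewrite -(rmorphM (comp_mpoly f)) /= qq comp_mpoly0 eqxx.
rewrite !(rmorphM (comp_mpoly f)) /=.
apply/eqP; rewrite -tofrac_eq tofracD !tofracM uE aE bE.
by apply/eqP; apply: clear_denominators; rewrite tofrac_eq0.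
Qed.

Lemma mpoly2_unit : (2 : {mpoly K[n.+1]}) \is a GRing.unit.
Proof.
by apply/mpoly_unitP; exists 2; rewrite ?mpolyC_nat // (pcharf0P _).1.
Qed.

Lemma rdvd_half h p : rdvd h (2 * p) -> rdvd h p.
Proof. by move=> [c cE]; exists (2^-1 * c); rewrite -mulrA -cE mulKr // mpoly2_unit. Qed.

(** If h divides q(f), it divides p(f) for some prime p of q. It also divides a(f), so p divides a
    by [rdvd_comp] and cancels. *)
Lemma reduce_denominator h u q a : mirreducible h -> q != 0 ->
  u * (q \mPo f) = a \mPo f ->
  exists q' a', ~ rdvd h (q' \mPo f) /\ u * (q' \mPo f) = a' \mPo f.
Proof.
move=> hI; move: (leqnn (msize q)); move: {2}(msize q) => k.
elim: k => [|k IH] in q a *; move=> sq q0 uE.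
  by move: sq; rewrite leqn0 msize_poly_eq0 (negPf q0).
have [hq|] := classic (rdvd h (q \mPo f)); last by exists q, a.
have [p [pI [q1 qE] hp]] := irreducible_under (mirreducible_prime hI) q0 hq.
have [p0 pU _] := pI.
have [a1 aE] : rdvd p a.
  by apply: (rdvd_comp charK fN hI pI hp); rewrite -uE; apply: rdvd_mull.
apply: (IH q1 a1).
- rewrite -ltnS (leq_trans _ sq) // qE mulrC.
  by apply: msize_lt_divisor; rewrite // mulrC -qE.
- by apply: contraNneq q0 => q10; rewrite qE q10 mul0r.
- by apply: (mulIf (comp_neq0 charK domf p0)); rewrite -mulrA -!rmorphM -qE -aE.
Qed.

Lemma rdvd_radicand h : rdvd h s -> rdvd h (D \mPo f).
Proof. by rewrite -s_sqr expr2; apply: rdvd_mull. Qed.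

(* u lies in the local ring at V(h) of the double cover z^2 = D(y): the map to
   this cover is birational and does not contract V(h). *)
Lemma local_fraction h u : mirreducible h -> exists a b a' b',
  ~ rdvd h (a \mPo f + (b \mPo f) * s) /\
  u * (a \mPo f + (b \mPo f) * s) = a' \mPo f + (b' \mPo f) * s.
Proof.
move=> hI; have [q [a [b [q0]]]] := integral_span u.
move: (leqnn (msize q)); move: {2}(msize q) => k.
elim: k => [|k IH] in q a b q0 *; move=> sq uE.
  by move: sq; rewrite leqn0 msize_poly_eq0 (negPf q0).
have [hq|hq] := classic (rdvd h (q \mPo f)); last first.
  by exists q, 0, a, b; rewrite comp_mpoly0 mul0r addr0.
have hP := mirreducible_prime hI; have [_ _ h_mul] := hP.
(* If the conjugate a - b s is prime to h, then u = N(a + b s) / (q (a - b s))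
   and the common factors of q and of the norm can be cancelled; otherwise h
   divides a and b, which then share a factor with q. *)
have [hM|hM] := classic (rdvd h (a \mPo f - (b \mPo f) * s)); last first.
  have [|q' [a' [hq' E]]] := @reduce_denominator h
      (u * (a \mPo f - (b \mPo f) * s)) q (a ^+ 2 - b ^+ 2 * D) hI q0.
    by rewrite mulrAC uE rmorphB /= rmorphXn
      [_ * D \mPo f]rmorphM /= rmorphXn -s_sqr /=; ring.
  exists (a * q'), (- (b * q')), a', 0.
  have ME : (a * q' \mPo f) + (- (b * q') \mPo f) * s =
      (a \mPo f - (b \mPo f) * s) * (q' \mPo f).
    by rewrite rmorphN !rmorphM /=; ring.
  rewrite ME comp_mpoly0 mul0r addr0 mulrA E; split=> //.
  by case/h_mul.
have hN : rdvd h (a \mPo f + (b \mPo f) * s) by rewrite -uE; apply: rdvd_mull.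
have ha : rdvd h (a \mPo f).
  apply: rdvd_half; rewrite (_ : 2 * (a \mPo f) =
    (a \mPo f + (b \mPo f) * s) + (a \mPo f - (b \mPo f) * s)).
    exact: rdvd_add.
  by ring.
have hbs : rdvd h ((b \mPo f) * s).
  rewrite (_ : (b \mPo f) * s = (a \mPo f + (b \mPo f) * s) - (a \mPo f)); last by ring.
  exact: rdvd_sub.
suff [p [pI pq hp hb]] : exists p,
    [/\ mirreducible p, rdvd p q, rdvd h (p \mPo f) & rdvd h (b \mPo f)].
  have [p0 pU _] := pI.
  have [a1 aE] := rdvd_comp charK fN hI pI hp ha.
  have [b1 bE] := rdvd_comp charK fN hI pI hp hb.
  have [q1 qE] := pq.
  apply: (IH q1 a1 b1).
  - by apply: contraNneq q0 => q10; rewrite qE q10 mul0r.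
  - rewrite -ltnS (leq_trans _ sq) // qE mulrC.
    by apply: msize_lt_divisor; rewrite // mulrC -qE.
  - apply: (mulIf (comp_neq0 charK domf p0)).
    by rewrite -mulrA -rmorphM -qE uE aE bE !rmorphM /=; ring.
have [hs|hs] := classic (rdvd h s); last first.
  have [p [pI pq hp]] := irreducible_under hP q0 hq.
  by exists p; split=> //; case: (h_mul _ _ hbs).
have hD := rdvd_radicand hs.
(* When h divides s, the common factor is D itself. Both a(f) and q(f) are multiples of D(f) = s^2,
   so cancelling s in b(f) s = u q(f) - a(f) leaves s as a factor of b(f). *)
exists D; split=> //; first exact: (rdvd_comp charK fN hI D_irr hD hq).
have [q1 qE] := rdvd_comp charK fN hI D_irr hD hq.
have [a1 aE] := rdvd_comp charK fN hI D_irr hD ha.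
rewrite (_ : b \mPo f = (u * (q1 \mPo f) - (a1 \mPo f)) * s); first exact: rdvd_mull.
apply: (mulIf sqrt_neq0).
rewrite -(addKr (a \mPo f) ((b \mPo f) * s)) -uE qE aE !rmorphM /= -s_sqr; ring.
Qed.

(** * Irreducibility of s *)

Lemma sqrt_nonunit : s \isn't a GRing.unit.
Proof.
apply/negP => /mpoly_unitP[c _ sE]; apply: s_notin; rewrite sE; exact: subfieldC.
Qed.

(** Let s = g h with h prime, and write h M = a'(f) + b'(f) s with M = a(f) + b(f) s prime to h.
    Then D divides a', so h M is a multiple of s = g h and g divides M. A prime of g would divide
    both s and M, hence a(f); then D would divide a, and h would divide M. *)
Lemma sqrt_irreducible : mirreducible s.
Proof.
have [h hP [g sE]] :=
  exists_prime_divisor (@factorial_mpoly K n.+1) sqrt_neq0 sqrt_nonunit.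
have hI := prime_mirreducible hP; have [h0 _ _] := hI.
have hs : rdvd h s by exists g.
have [gU|gU] := boolP (g \is a GRing.unit).
  by rewrite sE; apply: unit_mul_irreducible.
have [a [b [a' [b' [hM ME]]]]] := local_fraction h hI.
have [c cE] : rdvd D a'.
  apply: (rdvd_comp charK fN hI D_irr (rdvd_radicand hs)).
  rewrite (_ : a' \mPo f = h * (a \mPo f + (b \mPo f) * s) - (b' \mPo f) * s).
    by apply: rdvd_sub; [apply: rdvd_mulr; apply: rdvdd|apply: rdvd_mull].
  by rewrite ME; ring.
have gM : a \mPo f + (b \mPo f) * s = g * ((c \mPo f) * s + (b' \mPo f)).
  by apply: (mulfI h0); rewrite ME cE rmorphM /= -s_sqr [RHS]mulrA [h * g]mulrC -sE; ring.
have g0 : g != 0 by apply: contraNneq sqrt_neq0 => g0; rewrite sE g0 mul0r.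
have [h' hP' hg] := exists_prime_divisor (@factorial_mpoly K n.+1) g0 gU.
have hs' : rdvd h' s by rewrite sE; apply: rdvd_mulr.
have [d dE] : rdvd D a.
  apply: (rdvd_comp charK fN (prime_mirreducible hP') D_irr (rdvd_radicand hs')).
  rewrite (_ : a \mPo f = (a \mPo f + (b \mPo f) * s) - (b \mPo f) * s); last by ring.
  by apply: rdvd_sub; [rewrite gM; apply: rdvd_mulr|apply: rdvd_mull].
case: hM; apply: rdvd_add; last exact: rdvd_mull.
by rewrite dE rmorphM /=; apply/rdvd_mull/rdvd_radicand.
Qed.

(** * Comparison of s with the Jacobian determinant *)

Definition grad p : 'rV[{mpoly K[n.+1]}]_n.+1 := \row_j mderiv j p.
Definition radicand_grad : 'rV[{mpoly K[n.+1]}]_n.+1 :=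
  \row_j (mderiv j D \mPo f).

Lemma grad_sqr : radicand_grad *m jacobian f = (2 * s) *: grad s.
Proof.
apply/rowP => j; rewrite !mxE.
transitivity (mderiv j (D \mPo f)).
  by rewrite mderiv_comp; apply: eq_bigr => i _; rewrite !mxE.
by rewrite -s_sqr expr2 mderivM; ring.
Qed.

(** Multiplying [grad_sqr] by the adjugate shows that s divides |J| times each entry of (grad D)(f).
    If s did not divide |J|, [rdvd_comp] would make D divide its own partial derivatives; these
    would vanish for degree reasons, and D would be constant. *)
Lemma sqrt_rdvd_jacdet : rdvd s (jacdet f).
Proof.
have sI := sqrt_irreducible; have [_ _ s_mul] := mirreducible_prime sI.
apply: NNPP => ns; have [D0 DU _] := D_irr.
move/negP: DU; apply.
have dD i : mderiv i D = 0.
  have : radicand_grad *m (jacobian f *m \adj (jacobian f)) =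
         s *: (2 *: grad s *m \adj (jacobian f)).
    by rewrite mulmxA grad_sqr -!scalemxAl scalerA [s * 2]mulrC.
  rewrite mul_mx_adj mul_mx_scalar => /rowP/(_ i); rewrite !mxE => E.
  have [|//|si] := s_mul (jacdet f) (mderiv i D \mPo f).
    rewrite /jacdet E.
    exists (\sum_j (2 *: grad s) ord0 j * (\adj (jacobian f)) j i).
    by rewrite mulrC.
  have [c cE] := rdvd_comp charK fN sI D_irr (rdvd_radicand (rdvdd s)) si.
  apply/eqP/negPn/negP => d0.
  have c0 : c != 0 by apply: contraNneq d0 => c0; rewrite cE c0 mul0r.
  have := msize_mderiv i D; rewrite cE msizeM //.
  rewrite -msize_poly_eq0 in c0; rewrite -msize_poly_eq0 in D0; move: c0 D0.
  by case: (msize c) (msize D) => [|x] [|y] //= _ _; lia.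
have [c DE] := mderiv_all0 charK dD; apply/mpoly_unitP; exists c => //.
by rewrite -(mpolyC_eq0 n.+1) -DE.
Qed.

Lemma mderiv_span j a b :
  mderiv j (a \mPo f + (b \mPo f) * s) =
  \sum_i ((mderiv i a \mPo f) + (mderiv i b \mPo f) * s) * jacobian f i j
  + (b \mPo f) * mderiv j s.
Proof.
rewrite mderivD mderivM !mderiv_comp mulr_suml addrA -big_split /=; congr (_ + _).
by apply: eq_bigr => i _; rewrite mxE; ring.
Qed.

(** For a prime h of g, each coordinate x_k is a local fraction at V(h) with denominator M_k prime
    to h. Differentiating these expressions shows that h divides 2 times the product of the M_k, a
    contradiction. *)
Lemma jacdet_cofactor_unit g : jacdet f = g * s -> g \is a GRing.unit.
Proof.
move=> gE; apply/negPn/negP => gU.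
have g0 : g != 0 by apply: contraNneq domf => g0; rewrite gE g0 mul0r.
have [h hP hg] := exists_prime_divisor (@factorial_mpoly K n.+1) g0 gU.
have hI := prime_mirreducible hP.
have /fin_all_exists[a /fin_all_exists[b /fin_all_exists[a' /fin_all_exists[b' abP]]]] :=
  fun k => local_fraction 'X_k hI.
pose M k := a k \mPo f + (b k \mPo f) * s.
(* Differentiate x_k M_k = a'_k(f) + b'_k(f) s: row k of [C] collects the coefficients of the
   gradients of the f_i, and entry k of [v] that of grad s. *)
pose C := \matrix_(k, i) ((mderiv i (a' k) \mPo f) + (mderiv i (b' k) \mPo f) * s
  - 'X_k * ((mderiv i (a k) \mPo f) + (mderiv i (b k) \mPo f) * s)).
pose v := \col_k ((b' k \mPo f) - 'X_k * (b k \mPo f)).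
have CJ : C *m jacobian f + v *m grad s = diag_mx (\row_k M k).
  apply/matrixP => k j; rewrite !mxE big_ord1 !mxE.
  have [_ /(congr1 (mderiv j))] := abP k.
  rewrite mderivM mderivX mnm1E !mderiv_span -/(M k) => E.
  (* The derivative of x_k in x_j is presented with a truncated exponent: the monomial is 1 for k =
     j, and its coefficient is 0 otherwise. *)
  have -> : M k *+ (k == j) = ((k == j)%:R *: 'X_[U_(k) - U_(j)]) * M k.
    case: eqP => [<-|_]; last by rewrite scale0r mul0r.
    by rewrite scale1r -{1}[U_(k)%MM]add0m addmK mpolyX0 mul1r.
  apply: (addIr ('X_k * (\sum_i ((mderiv i (a k) \mPo f) + (mderiv i (b k) \mPo f) * s)
      * jacobian f i j + (b k \mPo f) * mderiv j s))).
  rewrite E mulrDr mulr_sumr addrACA -big_split /=; congr (_ + _); last by ring.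
  by apply: eq_bigr => i _; rewrite !mxE; ring.
(* XY below is block triangular since 2 s grad s = (grad D)(f) J; comparing
   determinants gives det X * |J| = 2 s * prod M. *)
pose X := block_mx C v (- radicand_grad) (2 * s)%:M.
pose Y := block_mx (jacobian f) 0 (grad s) (1%:M : 'M_1).
have XY : X *m Y = block_mx (diag_mx (\row_k M k)) v 0 (2 * s)%:M.
  rewrite mulmx_block !mulmx0 !mulmx1 !add0r CJ mulNmx grad_sqr mul_scalar_mx.
  by rewrite addNr.
have hs2 : rdvd h (2 * \prod_k M k).
  have : \det X * jacdet f = (2 * \prod_k M k) * s.
    have := congr1 determinant XY.
    rewrite det_mulmx det_lblock det_ublock det1 mulr1 det_diag det_scalar1.
    by rewrite -/(jacdet f) => ->; under eq_bigr do rewrite mxE; ring.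
  rewrite gE mulrA => /(mulIf sqrt_neq0) <-; exact: rdvd_mull.
have [k _] := prime_rdvd_prod hP (rdvd_half hs2).
by have [hM _] := abP k.
Qed.

End Ramification.

Theorem theorem4 (K : closedFieldType) (n : nat)
  (charK : [pchar K] =i pred0) (n_ge1 : (1 <= n)%N)
  (f : polymap K n)
  (deg2 : degree_two f) (nocontr : no_contracted_divisors f)
  (tau : {rmorphism ratfun K n -> ratfun K n})
  (tau_bij : bijective tau)
  (tau_fix : forall u, subfield_gen f u -> tau u = u)
  (tau_nontriv : exists u, tau u != u) :
  (exists (c : K) (s : {mpoly K[n]}),
      [/\ c != 0, mirreducible s, tau (s%:F) = - (s%:F) &
          jacdet f = c *: s])
  /\ (mirreducible (jacdet f) /\ tau ((jacdet f)%:F) = - ((jacdet f)%:F)).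
Proof.
case: n n_ge1 f deg2 nocontr tau tau_bij tau_fix tau_nontriv => // n _ f.
move=> [domf deg2] fN tau _ tau_fix [u0 tau_u0].
have nFu0 : ~ subfield_gen f u0.
  by move=> /tau_fix u0_fix; rewrite u0_fix eqxx in tau_u0.
have [w [D0 [nFw wE]]] := exists_sqrt charK deg2 nFu0.
have [s [D [D_irr sE nFs]]] := irreducible_radicand charK domf fN nFw wE.
have s_irr := sqrt_irreducible charK domf fN deg2 D_irr sE nFs.
have [g gE] := sqrt_rdvd_jacdet charK domf fN deg2 D_irr sE nFs.
have gU := jacdet_cofactor_unit charK domf fN deg2 D_irr sE nFs gE.
have [c c0 gC] := mpoly_unitP g gU.
(* As [tau] fixes s^2 = D(f), it sends s to s or -s. Fixing s would fix all of K(f) + K(f) s = K(x),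
   in particular [u0]. *)
have tau_s : tau s%:F = - s%:F.
  have : tau s%:F ^+ 2 == s%:F ^+ 2.
    by rewrite -rmorphXn -tofracXn sE tau_fix //; apply: subfield_comp.
  rewrite eqf_sqr => /orP[]/eqP // fix_s; move: tau_u0.
  have [a [b [Fa Fb ->]]] := subfield_span u0 deg2 nFs.
  by rewrite rmorphD rmorphM /= fix_s !tau_fix // eqxx.
have jE : jacdet f = c *: s by rewrite gE gC mul_mpolyC.
split; first by exists c, s.
split; first by rewrite gE; apply: unit_mul_irreducible.
rewrite gE tofracM rmorphM /= tau_s mulrN tau_fix // gC; exact: subfieldC.
Qed.
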